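(* Let $\alpha$ be a left c.e.\ real given by a program $P_\alpha$ enumerating a computable sequence of rationals converging to $\alpha$ from below. There is a constant $d\in\mathbb{N}$, computable from $l(P_\alpha)$, such that if $C(\alpha_n)>C(n)+d$ for all $n$, then there is a partial computable function $f$ with $f(\alpha_n,n)=C(0_n)$ for all $n$; hence from $\alpha_n$ one computes $C(n)$ given $n$, for all $n$.
   Context: $C$ denotes plain Kolmogorov complexity with respect to a fixed universal, additively optimal binary Turing machine; $0_n$ is the string of $n$ zeros. A left c.e.\ real is the limit of a computable increasing sequence of rationals; $\alpha_n$ denotes the first $n$ binary digits of $\alpha$; $l(P)$ is the length of a program $P$. *)

(* Defs.v *)
From HB Require Import structures.
From mathcomp Require Import all_boot all_order all_algebra.
From mathcomp Require Import all_classical all_reals.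
From mathcomp Require Import topology normedtype sequences.

Set Implicit Arguments.
Unset Strict Implicit.
Unset Printing Implicit Defensive.

Import Order.TTheory GRing.Theory Num.Theory.
Import numFieldNormedType.Exports.
Local Open Scope classical_set_scope.

(* A partial function nat^k -> nat, given by its graph: [F xs y] reads
   "F xs is defined and equal to y". *)
Definition pfun k := k.-tuple nat -> nat -> Prop.

Fixpoint prec_graph k (F : pfun k) (G : pfun k.+2) n (xs : k.-tuple nat) y :=
  if n is m.+1 then
    exists2 z, prec_graph F G m xs z & G [tuple of m :: z :: xs] y
  else F xs y.

(* The partial recursive functions: the least class of partial functions that
   contains zero, successor and the projections and is closed under
   composition, primitive recursion and minimization; [pr_ext] makes the class
   independent of the way the graphs are written. *)
Inductive partrec : forall k, pfun k -> Prop :=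
| pr_zero k : partrec (fun (_ : k.-tuple nat) y => y = 0)
| pr_succ : partrec (fun (xs : 1.-tuple nat) y => y = (thead xs).+1)
| pr_proj k (i : 'I_k) : partrec (fun (xs : k.-tuple nat) y => y = tnth xs i)
| pr_comp k m (F : pfun m) (G : 'I_m -> pfun k) :
    partrec F -> (forall i, partrec (G i)) ->
    partrec (fun xs y => exists2 ys : m.-tuple nat,
                           forall i, G i xs (tnth ys i) & F ys y)
| pr_prec k (F : pfun k) (G : pfun k.+2) :
    partrec F -> partrec G ->
    partrec (fun (xs : k.+1.-tuple nat) y =>
               prec_graph F G (thead xs) [tuple of behead xs] y)
| pr_min k (F : pfun k.+1) :
    partrec F ->
    partrec (fun (xs : k.-tuple nat) y =>
               F [tuple of y :: xs] 0 /\
               forall z, z < y -> exists v, F [tuple of z :: xs] v.+1)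
| pr_ext k (F G : pfun k) :
    (forall xs y, F xs y <-> G xs y) -> partrec F -> partrec G.

Definition computable_nat (g : nat -> nat) :=
  partrec (fun (xs : 1.-tuple nat) y => y = g (thead xs)).

(* The length-lexicographic bijection between strings and numbers:
   empty, 0, 1, 00, 01, 10, 11, 000, ... correspond to 0, 1, 2, 3, ... *)
Definition nat_of_bits : bitseq -> nat := foldl (fun n (b : bool) => n.*2 + b.+1) 0.

Fixpoint bits_of_nat_rec fuel n : bitseq :=
  if fuel is fuel'.+1 then
    if n is m.+1 then rcons (bits_of_nat_rec fuel' m./2) (odd m) else [::]
  else [::].

Definition bits_of_nat n := bits_of_nat_rec n n.

Lemma bits_of_natK : cancel bits_of_nat nat_of_bits.
Proof.
move=> n; rewrite /bits_of_nat.
suff H f m : m <= f -> nat_of_bits (bits_of_nat_rec f m) = m by exact: H.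
elim: f m => [|f IHf] [|m] //= lemf.
rewrite /nat_of_bits -cats1 foldl_cat /= -/(nat_of_bits _) IHf.
  by rewrite addnS addnC odd_double_half.
apply: leq_trans (_ : m <= f) => //.
by rewrite leq_half_double -addnn -addnS leq_addr.
Qed.

Lemma nat_of_bits_inj : injective nat_of_bits.
Proof.
have Ercons s b : nat_of_bits (rcons s b) = ((nat_of_bits s).*2 + b).+1.
  by rewrite /nat_of_bits -cats1 foldl_cat /= addnS.
elim/last_ind => [|s b IHs]; elim/last_ind => [|t c _] //; rewrite ?Ercons //.
move=> [E]; have Ebc : b = c.
  by have /(congr1 odd) := E; rewrite !oddD !odd_double /= !oddb.
congr rcons => //; apply: IHs; apply: double_inj.
by move: E; rewrite Ebc => /addIn.
Qed.

Lemma nat_of_bitsK : cancel nat_of_bits bits_of_nat.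
Proof. by move=> s; apply: nat_of_bits_inj; rewrite bits_of_natK. Qed.

Definition pcomputable1 (phi : bitseq -> option bitseq) :=
  exists2 F : pfun 1, partrec F &
    forall x z, phi x = Some z <-> F [tuple nat_of_bits x] (nat_of_bits z).

Definition pcomputable2 (phi : bitseq -> bitseq -> option bitseq) :=
  exists2 F : pfun 2, partrec F &
    forall x y z, phi x y = Some z <->
      F [tuple nat_of_bits x; nat_of_bits y] (nat_of_bits z).

(* A machine maps a program and an input to at most one output. *)
Definition machine := bitseq -> bitseq -> option bitseq.

Definition universal (U : machine) :=
  forall phi, pcomputable1 phi -> exists p, forall x, U p x = phi x.

Definition additively_optimal (U : machine) :=
  forall V : machine, pcomputable2 V ->
    exists c, forall p x z, V p x = Some z ->
      exists2 p', size p' <= size p + c & U p' x = Some z.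

Record reference_machine (U : machine) : Prop := ReferenceMachine {
  ref_pcomputable : pcomputable2 U;
  ref_universal : universal U;
  ref_optimal : additively_optimal U }.

(* Plain complexity: the length of a shortest program that outputs x on the
   empty input. The default value 0 is never used when U is additively optimal,
   by [plainCP]. *)
Definition plainC (U : machine) (x : bitseq) : nat :=
  xget 0 [set k | (exists2 p, size p = k & U p [::] = Some x) /\
                  forall p, U p [::] = Some x -> k <= size p].

Definition plainC_nat (U : machine) (n : nat) : nat := plainC U (bits_of_nat n).

Lemma plainCP (U : machine) x : additively_optimal U ->
  (exists2 p, size p = plainC U x & U p [::] = Some x) /\
  forall p, U p [::] = Some x -> plainC U x <= size p.
Proof.
move=> optU; rewrite /plainC; case: xgetP => [k _ //|noC].
have [|c Hc] := optU (fun p _ => Some p).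
  exists (fun (xs : 2.-tuple nat) y => y = tnth xs ord0); first exact: pr_proj.
  move=> p y z; rewrite (tnth_nth 0) /=; split=> [[->] //|].
  by move/nat_of_bits_inj ->.
have [p0 _ Up0] := Hc x [::] x erefl.
pose Q k := `[< exists2 p, size p = k & U p [::] = Some x >].
have exQ : exists k, Q k by exists (size p0); apply/asboolP; exists p0.
case: (ex_minnP exQ) => k /asboolP Qk mink.
by case: (noC k); split=> // p Up; apply: mink; apply/asboolP; exists p.
Qed.

Local Open Scope ring_scope.

(* Every string denotes a rational: the entries s, a, b of the sequence it codes
   stand for (-1)^s * a / (b + 1); a missing entry counts as 0. *)
Definition rat_of_bits (w : bitseq) : rat :=
  let s := CodeSeq.decode (nat_of_bits w) in
  (-1) ^+ nth 0%N s 0 * (nth 0%N s 1)%:R / (nth 0%N s 2).+1%:R.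

(* On input k, the program P outputs the k-th term of a nondecreasing sequence of
   rationals with limit alpha. *)
Definition enumerates_from_below (R : realType) (U : machine) (P : bitseq)
    (alpha : R) :=
  exists q : nat -> rat,
    [/\ forall k, exists2 w, U P (bits_of_nat k) = Some w & rat_of_bits w = q k,
        nondecreasing_seq q
      & (fun k => ratr (q k) : R) @ \oo --> alpha].

(* The first n binary digits after the point, i.e. those of the fractional part;
   a dyadic rational gets its terminating expansion. The i-th digit is the parity
   of the floor of 2^i alpha. *)
Definition first_digits (R : realType) (alpha : R) (n : nat) : bitseq :=
  mkseq (fun i => odd `|Num.floor (2 ^+ i.+1 * alpha)|%N) n.

(* Main.v *)
Require Import Defs.
From mathcomp Require Import all_boot all_order all_algebra.
From mathcomp Require Import all_classical all_reals.
From mathcomp Require Import topology normedtype sequences.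
From mathcomp Require Import zify.

(* For [n] large, let [s] be the stage at which the approximations to [alpha] settle
   on the digits [alpha_n]. If a shortest program for [n] (or for [0_n]) halted only
   after stage [s], then running it and printing [n] digits of the approximation
   reached at its halting time would describe [alpha_n] by the program together with
   [P], giving [C(alpha_n) <= C(n) + D(l(P))]. So under the hypothesis all shortest
   programs for [n] halt by stage [s]; as [s] can be found from [alpha_n] and [n], so
   can [C(n)]. The finitely many small [n] are treated by a table. *)

(** The program for [n] must enter the description of [alpha_n] with its exact length, so [P] goes
    into a unary header. The pair of [a] and [m] is the code [2 ^ a * (2 * m + 1)], at most [a + 1]
    bits longer than [m], and [a] is twice the code of [P] plus one bit, hence below
    [2 ^ (l(P) + 2)]. This is the origin of the exponential term in [D]. The number [n] costs
    nothing, being recovered from the output of its program. Two obstacles shape the treatment of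
    digits. If [alpha] is dyadic and never reached, the floors of [2 ^ n * q] settle on
    [2 ^ n * alpha - 1] for large [n]; the extra bit of [a] tells whether to add 1. And the digits
    only see [alpha] modulo 1, so an early stage may show the right ones by coincidence and lose
    them later. Stages are therefore searched only from an [s0] on, after which the approximations
    are within 1/2 of [alpha]; then right digits persist up to any later halting time. The resulting
    function has [P], the bit, [s0] and the table built in. *)

Set Implicit Arguments.
Unset Strict Implicit.
Unset Printing Implicit Defensive.

Import Order.TTheory GRing.Theory Num.Theory.

(** * Closure properties of the computable functions on lists *)

(* Arguments are read from a list, a missing one counting as 0; quantifying over
   all arities makes the two classes below independent of the arity. *)
Definition pcompute (F : seq nat -> nat -> Prop) :=
  forall k, partrec (fun xs : k.-tuple nat => F xs).

Definition tcompute (f : seq nat -> nat) := pcompute (fun s y => y = f s).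

Lemma pcompute_ext F G : (forall s y, F s y <-> G s y) -> pcompute F -> pcompute G.
Proof. by move=> FG HF k; apply: pr_ext (HF k). Qed.

Lemma tcompute_ext f g : f =1 g -> tcompute f -> tcompute g.
Proof. by move=> fg; apply: pcompute_ext => s y; rewrite fg. Qed.

Lemma tcompute_const c : tcompute (fun=> c).
Proof.
elim: c => [|c IHc] k; first exact: pr_zero.
pose G (i : 'I_1) (xs : k.-tuple nat) y := y = c.
apply: pr_ext (pr_comp pr_succ (fun i : 'I_1 => IHc k : partrec (G i))).
move=> xs y; split=> [[ys /(_ ord0) + ->]|->].
  by rewrite /G /thead => ->.
by exists [tuple c]; rewrite ?theadE // => i; rewrite /G ord1 (tnth_nth 0).
Qed.

Lemma tcompute_nth i : tcompute (fun s => nth 0 s i).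
Proof.
move=> k; have [ltik|leki] := ltnP i k.
  apply: pr_ext (pr_proj (Ordinal ltik)) => xs y.
  by rewrite (tnth_nth 0).
apply: pr_ext (pr_zero k) => xs y.
by rewrite nth_default // size_tuple.
Qed.

(** Substitutions of computable lists for the argument list. The list [gs] may depend on the arity
    [k], which is what admits the identity and [behead]. *)
Definition env (r : seq nat -> seq nat) :=
  forall k, exists2 gs : seq (seq nat -> nat),
    forall i, tcompute (nth (fun=> 0) gs i) &
    forall xs : k.-tuple nat, r xs = [seq g (xs : seq nat) | g <- gs].

Lemma env_nil : env (fun=> [::]).
Proof. by move=> k; exists [::] => // i; rewrite nth_nil; apply: tcompute_const. Qed.

Lemma env_id : env (fun s => s).
Proof.
move=> k; exists [seq (fun s => nth 0 s i) | i <- iota 0 k] => [i|xs].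
  have [ltik|leki] := ltnP i k.
    by rewrite (nth_map 0) ?size_iota //; apply: tcompute_nth.
  by rewrite nth_default ?size_map ?size_iota //; apply: tcompute_const.
rewrite -map_comp; apply: (@eq_from_nth _ 0) => [|i].
  by rewrite size_map size_iota size_tuple.
by rewrite size_tuple => ltik; rewrite (nth_map 0) ?size_iota //= nth_iota.
Qed.

Lemma env_behead r : env r -> env (fun s => behead (r s)).
Proof.
move=> Hr k; have [gs Hgs Er] := Hr k; exists (behead gs) => [i|xs].
  by rewrite nth_behead.
by rewrite Er; case: gs {Er Hgs}.
Qed.

Lemma env_cons g r : tcompute g -> env r -> env (fun s => g s :: r s).
Proof.
move=> Hg Hr k; have [gs Hgs Er] := Hr k; exists (g :: gs) => [[|i]|xs] //=.
by rewrite Er.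
Qed.

Lemma partrec_comp k m (F : pfun m) (g : 'I_m -> seq nat -> nat) :
  partrec F -> (forall i, tcompute (g i)) ->
  partrec (fun (xs : k.-tuple nat) => F [tuple g i xs | i < m]).
Proof.
move=> HF Hg; apply: pr_ext (pr_comp HF (fun i => Hg i k)) => xs y.
split=> [[ys Eys]|Fy]; last by exists [tuple g i xs | i < m] => // i; rewrite tnth_mktuple.
suff -> : ys = [tuple g i xs | i < m] by [].
by apply: eq_from_tnth => i; rewrite tnth_mktuple Eys.
Qed.

Lemma pcompute_env F r : pcompute F -> env r -> pcompute (fun s => F (r s)).
Proof.
move=> HF Hr k; have [gs Hgs Er] := Hr k.
apply: pr_ext (partrec_comp k (HF (size gs)) (fun i : 'I_(size gs) => Hgs i)) => xs y.
suff -> : r xs = [tuple nth (fun=> 0) gs i xs | i < size gs] by [].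
rewrite Er; apply: (@eq_from_nth _ 0) => [|i]; first by rewrite size_map size_tuple.
rewrite size_map => lti; rewrite (nth_map (fun=> 0)) //.
by rewrite -[i]/(nat_of_ord (Ordinal lti)) -tnth_nth tnth_mktuple.
Qed.

Lemma tcompute_env f r : tcompute f -> env r -> tcompute (fun s => f (r s)).
Proof. by move=> Hf; apply: (pcompute_env Hf). Qed.

Lemma tcompute_nth_env i r : env r -> tcompute (fun s => nth 0 (r s) i).
Proof. exact: tcompute_env (tcompute_nth i). Qed.

Lemma partrec_bind k (F : pfun k) (G : pfun k.+1) : partrec F -> partrec G ->
  partrec (fun xs y => exists2 z, F xs z & G [tuple of z :: xs] y).
Proof.
move=> HF HG.
pose H i xs y := if unlift ord0 i is Some j then y = tnth xs j else F xs y.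
have HH i : partrec (H i).
  by rewrite /H; case: unlift => [j|] //; apply: pr_proj.
apply: pr_ext (pr_comp HG HH) => xs y; split=> [[ys Eys Gy]|[z Fz Gy]].
  exists (tnth ys ord0); first by have := Eys ord0; rewrite /H unlift_none.
  suff -> : [tuple of tnth ys ord0 :: xs] = ys by [].
  apply: eq_from_tnth => i; case: (unliftP ord0 i) => [j|] -> //.
  by have := Eys (lift ord0 j); rewrite /H liftK tnthS => ->.
exists [tuple of z :: xs] => // i; rewrite /H.
by case: (unliftP ord0 i) => [j|] -> //; rewrite tnthS.
Qed.

(** The intermediate value is pushed on the front of the list, so every input moves up by one
    position for [G]. Nested searches rely on this shift of indices. *)
Lemma pcompute_bind F G : pcompute F -> pcompute G ->
  pcompute (fun s y => exists2 z, F s z & G (z :: s) y).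
Proof. by move=> HF HG k; apply: partrec_bind (HF k) (HG k.+1). Qed.

Lemma pcompute_mu g : tcompute g ->
  pcompute (fun s y => g (y :: s) = 0 /\ forall z, z < y -> g (z :: s) <> 0).
Proof.
move=> Hg k; apply: pr_ext (pr_min (Hg k.+1)) => xs y.
split=> -[gy gz]; split=> // z /gz; first by case=> v /= <-.
by move=> /= nz; exists (g (z :: xs)).-1; move: nz; case: (g _).
Qed.

Lemma tcompute_mu f g : tcompute g ->
  (forall s, g (f s :: s) = 0 /\ forall z, z < f s -> g (z :: s) <> 0) -> tcompute f.
Proof.
move=> Hg Hf; apply: pcompute_ext (pcompute_mu Hg) => s y; have [gf gz] := Hf s.
split=> [[gy gz']|->] //; case: (ltngtP y (f s)) => // lt.
  by have := gz _ lt.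
by have := gz' _ lt.
Qed.

Lemma tcompute_nat_rec f g n :
  tcompute f -> tcompute (fun s => g (nth 0 s 0) (nth 0 s 1) (behead (behead s))) ->
  tcompute n -> tcompute (fun s => nat_rec (fun=> nat) (f s) (fun m z => g m z s) (n s)).
Proof.
move=> Hf Hg Hn k.
have Hprec := pr_prec (Hf k) (Hg k.+2).
apply: pr_ext (partrec_bind (Hn k) Hprec) => xs y.
have E z m : prec_graph (fun (ys : k.-tuple nat) y => y = f ys)
   (fun (ys : k.+2.-tuple nat) y =>
      y = g (nth 0 ys 0) (nth 0 ys 1) (behead (behead ys))) m xs z
   <-> z = nat_rec (fun=> nat) (f xs) (fun m z => g m z xs) m.
  elim: m z => [|m IHm] z //=; split=> [[z' /IHm -> ->] //|->].
  by exists (nat_rec (fun=> nat) (f xs) (fun m z => g m z xs) m) => //; apply/IHm.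
have Eb z : [tuple of behead [tuple of z :: xs]] = xs by apply: val_inj.
split=> [[z ->]|->]; first by rewrite theadE Eb => /E.
by exists (n xs) => //; rewrite theadE Eb; apply/E.
Qed.

Create HintDb comp.
Ltac solve_compute := solve [eauto 100 with comp nocore].
#[local] Hint Resolve tcompute_const tcompute_nth_env env_nil env_id env_behead env_cons : comp.

Lemma tcompute_succ f : tcompute f -> tcompute (fun s => (f s).+1).
Proof.
move=> Hf k; apply: pr_ext (pr_comp pr_succ (fun i : 'I_1 => Hf k)) => xs y.
split=> [[ys /(_ ord0) + ->]|->]; first by rewrite /thead => ->.
by exists [tuple f xs]; rewrite ?theadE // => i; rewrite ord1 (tnth_nth 0).
Qed.
#[local] Hint Resolve tcompute_succ : comp.

Lemma tcompute_add f g : tcompute f -> tcompute g -> tcompute (fun s => f s + g s).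
Proof.
move=> Hf Hg; apply: (tcompute_ext _ (@tcompute_nat_rec g (fun _ z _ => z.+1) f _ _ _)).
- by move=> s; elim: (f s) => //= n ->.
all: solve_compute.
Qed.
#[local] Hint Resolve tcompute_add : comp.

Lemma tcompute_mul f g : tcompute f -> tcompute g -> tcompute (fun s => f s * g s).
Proof.
move=> Hf Hg.
have Hg2 : tcompute (fun s => g (behead (behead s))) by apply: tcompute_env => //; solve_compute.
apply: (tcompute_ext _ (@tcompute_nat_rec (fun=> 0) (fun _ z s => g s + z) f _ _ _)).
- by move=> s; elim: (f s) => //= n ->.
all: solve_compute.
Qed.
#[local] Hint Resolve tcompute_mul : comp.

Lemma tcompute_exp f g : tcompute f -> tcompute g -> tcompute (fun s => f s ^ g s).
Proof.
move=> Hf Hg.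
have Hf2 : tcompute (fun s => f (behead (behead s))) by apply: tcompute_env => //; solve_compute.
apply: (tcompute_ext _ (@tcompute_nat_rec (fun=> 1) (fun _ z s => f s * z) g _ _ _)).
- by move=> s; elim: (g s) => //= n ->; rewrite expnS.
all: solve_compute.
Qed.
#[local] Hint Resolve tcompute_exp : comp.

Lemma tcompute_pred f : tcompute f -> tcompute (fun s => (f s).-1).
Proof.
move=> Hf; apply: (tcompute_ext _ (@tcompute_nat_rec (fun=> 0) (fun m _ _ => m) f _ _ _)).
- by move=> s; case: (f s).
all: solve_compute.
Qed.
#[local] Hint Resolve tcompute_pred : comp.

Lemma tcompute_sub f g : tcompute f -> tcompute g -> tcompute (fun s => f s - g s).
Proof.
move=> Hf Hg; apply: (tcompute_ext _ (@tcompute_nat_rec f (fun _ z _ => z.-1) g _ _ _)).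
- by move=> s; elim: (g s) => [|n IHn] /=; rewrite ?subn0 // IHn subnS.
all: solve_compute.
Qed.
#[local] Hint Resolve tcompute_sub : comp.

Definition dcompute (b : seq nat -> bool) := tcompute (fun s => b s).

Lemma dcompute_leq f g : tcompute f -> tcompute g -> dcompute (fun s => f s <= g s).
Proof.
move=> Hf Hg; apply: (@tcompute_ext (fun s => 1 - (f s - g s))); last by solve_compute.
by move=> s; rewrite /leq; case: (f s - g s) => // n; rewrite subSS sub0n.
Qed.
#[local] Hint Resolve dcompute_leq : comp.

Lemma dcompute_neg b : dcompute b -> dcompute (fun s => ~~ b s).
Proof.
move=> Hb; apply: (@tcompute_ext (fun s => 1 - b s)); first by move=> s; case: (b s).
by move: Hb; rewrite /dcompute => Hb; solve_compute.
Qed.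

Lemma dcompute_and a b : dcompute a -> dcompute b -> dcompute (fun s => a s && b s).
Proof.
rewrite /dcompute => Ha Hb.
apply: (@tcompute_ext (fun s => a s * b s)); first by move=> s; rewrite mulnb.
solve_compute.
Qed.
#[local] Hint Resolve dcompute_neg dcompute_and : comp.

Lemma dcompute_or a b : dcompute a -> dcompute b -> dcompute (fun s => a s || b s).
Proof.
move=> Ha Hb; apply: (@tcompute_ext (fun s => ~~ (~~ a s && ~~ b s))).
  by move=> s; rewrite negb_and !negbK.
rewrite -/(dcompute (fun s => ~~ (~~ a s && ~~ b s))); solve_compute.
Qed.

Lemma dcompute_eq f g : tcompute f -> tcompute g -> dcompute (fun s => f s == g s).
Proof.
move=> Hf Hg; apply: (@tcompute_ext (fun s => (f s <= g s) && (g s <= f s))).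
  by move=> s; rewrite eqn_leq.
rewrite -/(dcompute (fun s => (f s <= g s) && (g s <= f s))); solve_compute.
Qed.
#[local] Hint Resolve dcompute_or dcompute_eq : comp.

Lemma tcompute_if b f g :
  dcompute b -> tcompute f -> tcompute g -> tcompute (fun s => if b s then f s else g s).
Proof.
rewrite /dcompute => Hb Hf Hg.
apply: (@tcompute_ext (fun s => b s * f s + (1 - b s) * g s)); last by solve_compute.
by move=> s; case: (b s); rewrite !(mul1n, mul0n, addn0, add0n).
Qed.

Lemma tcompute_bool b : dcompute b -> tcompute (fun s => b s). Proof. by []. Qed.
#[local] Hint Resolve tcompute_if tcompute_bool : comp.

(** Lets a function be shown computable from a decidable specification rather than an algorithm:
    division, string length and [code_head] are all least witnesses. *)
Lemma tcompute_min f b : dcompute b ->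
  (forall s, b (f s :: s) /\ forall z, b (z :: s) -> f s <= z) -> tcompute f.
Proof.
move=> Hb Hf; apply: (@tcompute_mu _ (fun s => ~~ b s)).
  by rewrite -/(dcompute (fun s => ~~ b s)); solve_compute.
move=> s; have [-> minf] := Hf s; split=> // z ltz.
by case: (boolP (b _)) => // /minf; rewrite leqNgt ltz.
Qed.

Lemma tcompute_weak f : tcompute f -> tcompute (fun s => f (behead s)).
Proof. by move=> Hf; apply: tcompute_env Hf _; solve_compute. Qed.

Lemma tcompute_div f g : tcompute f -> tcompute g -> tcompute (fun s => f s %/ g s).
Proof.
move=> /[dup] Hf /tcompute_weak Hf' /[dup] Hg /tcompute_weak Hg'.
(* The first disjunct makes 0 the least witness when the divisor is 0, in agreement with [divn0]. *)
apply: (@tcompute_min _ (fun s => (g (behead s) == 0) ||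
         (f (behead s) < g (behead s) * (nth 0 s 0).+1))); first by solve_compute.
move=> s /=; have [->|g_gt0] := posnP (g s); first by rewrite divn0.
rewrite /=; rewrite mulnC ltn_ceil //; split=> // z.
by rewrite mulnC -ltn_divLR.
Qed.
#[local] Hint Resolve tcompute_div : comp.

Lemma tcompute_mod f g : tcompute f -> tcompute g -> tcompute (fun s => f s %% g s).
Proof.
move=> Hf Hg; apply: (@tcompute_ext (fun s => f s - f s %/ g s * g s)); last by solve_compute.
by move=> s; rewrite {1}(divn_eq (f s) (g s)) addKn.
Qed.
#[local] Hint Resolve tcompute_mod : comp.

Lemma dcompute_odd f : tcompute f -> dcompute (fun s => odd (f s)).
Proof.
move=> Hf; apply: (@tcompute_ext (fun s => f s %% 2)); last by solve_compute.
by move=> s; rewrite modn2.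
Qed.

Lemma tcompute_half f : tcompute f -> tcompute (fun s => (f s)./2).
Proof.
move=> Hf; apply: (@tcompute_ext (fun s => f s %/ 2)); last by solve_compute.
by move=> s; rewrite divn2.
Qed.
#[local] Hint Resolve dcompute_odd tcompute_half : comp.

Lemma tcompute_table (t : seq nat) f : tcompute f -> tcompute (fun s => nth 0 t (f s)).
Proof.
elim: t f => [|a t IHt] f Hf.
  by apply: tcompute_ext (tcompute_const 0) => s; rewrite nth_nil.
have Ht := IHt _ (tcompute_pred Hf).
apply: (@tcompute_ext (fun s => if f s == 0 then a else nth 0 t (f s).-1)); last by solve_compute.
by move=> s; case: (f s).
Qed.
#[local] Hint Resolve tcompute_table : comp.

(** * Length of strings in terms of their codes *)

Lemma nat_of_bits_rcons s b : nat_of_bits (rcons s b) = ((nat_of_bits s).*2 + b).+1.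
Proof. by rewrite /nat_of_bits -cats1 foldl_cat /= addnS. Qed.

Lemma nat_of_bits_bounds s :
  2 ^ size s <= (nat_of_bits s).+1 < 2 ^ (size s).+1.
Proof.
elim/last_ind: s => [|s b IHs] //; rewrite nat_of_bits_rcons size_rcons !expnS.
by move: IHs; rewrite !expnS; case: b; lia.
Qed.

Definition len n := size (bits_of_nat n).

Lemma len_nat_of_bits w : len (nat_of_bits w) = size w.
Proof. by rewrite /len nat_of_bitsK. Qed.

Lemma len_bounds n : 2 ^ len n <= n.+1 < 2 ^ (len n).+1.
Proof. by have := nat_of_bits_bounds (bits_of_nat n); rewrite bits_of_natK. Qed.

Lemma len_le n k : (len n <= k) = (n.+1 < 2 ^ k.+1).
Proof.
have /andP[lo hi] := len_bounds n; apply/idP/idP => [le|lt].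
  by apply: leq_trans hi _; rewrite leq_exp2l.
by rewrite -ltnS -(ltn_exp2l _ _ (isT : 1 < 2)) (leq_ltn_trans lo).
Qed.

(** Because of this, the least code of a program with a given output is the code of a shortest one,
    and minimization finds the complexity. *)
Lemma leq_len : {homo len : m n / m <= n}.
Proof.
move=> m n lemn; rewrite len_le; apply: leq_ltn_trans (_ : n.+1 < _) => //.
by rewrite -len_le.
Qed.

Lemma tcompute_len f : tcompute f -> tcompute (fun s => len (f s)).
Proof.
move=> /[dup] Hf /tcompute_weak Hf'.
apply: (@tcompute_min _ (fun s => (f (behead s)).+1 < 2 ^ (nth 0 s 0).+1)).
  by solve_compute.
by move=> s /=; rewrite -len_le; split=> // z; rewrite -len_le.
Qed.
#[local] Hint Resolve tcompute_len : comp.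

(** * Arithmetic of sequence codes *)

(* [code_head] and [code_tail] read the first entry and the code of the
   remaining entries off a sequence code; both are 0 on the empty sequence. *)
Definition code_head m := head 0 (CodeSeq.decode m).
Definition code_tail m := CodeSeq.code (behead (CodeSeq.decode m)).
Definition code_cons a m := CodeSeq.code (a :: CodeSeq.decode m).

Lemma code_consE a m : code_cons a m = 2 ^ a * m.*2.+1.
Proof. by rewrite /code_cons /= CodeSeq.decodeK. Qed.

Lemma code_head_cons a m : code_head (code_cons a m) = a.
Proof. by rewrite /code_head CodeSeq.codeK. Qed.

Lemma code_tail_cons a m : code_tail (code_cons a m) = m.
Proof. by rewrite /code_tail CodeSeq.codeK /= CodeSeq.decodeK. Qed.

Lemma code_pos m : 0 < m -> m = code_cons (code_head m) (code_tail m).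
Proof.
rewrite /code_cons /code_head /code_tail CodeSeq.codeK => m_gt0.
rewrite -{1}[m]CodeSeq.decodeK; case E: (CodeSeq.decode m) => [|a s] //.
by move: m_gt0; rewrite -[m]CodeSeq.decodeK E.
Qed.

(** By [code_consE], the head of a nonzero code is its 2-adic valuation, the least [z] such that
    [2 ^ z.+1] does not divide it. *)
Lemma tcompute_code_head f : tcompute f -> tcompute (fun s => code_head (f s)).
Proof.
move=> /[dup] Hf /tcompute_weak Hf'.
apply: (@tcompute_min _ (fun s => (f (behead s) == 0) ||
   ~~ (f (behead s) %% 2 ^ (nth 0 s 0).+1 == 0))); first by solve_compute.
move=> s /=; have [->|f_gt0] := posnP (f s); first by [].
rewrite /= {1 3}(code_pos f_gt0) code_consE; set a := code_head _; set m := code_tail _.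
split=> [|z].
  by rewrite -/(dvdn _ _) expnSr dvdn_pmul2l ?expn_gt0 // dvdn2 /= odd_double.
rewrite -/(dvdn _ _); apply: contraR; rewrite -ltnNge => ltza.
by apply: dvdn_mulr; rewrite dvdn_exp2l.
Qed.

Lemma code_tailE m : code_tail m = (m %/ 2 ^ code_head m)./2.
Proof.
have [->|m_gt0] := posnP m; first by [].
rewrite {2}(code_pos m_gt0) code_consE mulKn ?expn_gt0 //.
by rewrite /= uphalf_double.
Qed.

#[local] Hint Resolve tcompute_code_head : comp.

Lemma tcompute_code_tail f : tcompute f -> tcompute (fun s => code_tail (f s)).
Proof.
move=> Hf; apply: (@tcompute_ext (fun s => (f s %/ 2 ^ code_head (f s))./2)); last by solve_compute.
by move=> s; rewrite code_tailE.
Qed.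
#[local] Hint Resolve tcompute_code_tail : comp.

(** * Time-bounded evaluation of partial recursive functions *)

(* [E (t :: xs)] is [y.+1] if [F xs] is seen to have the value [y] within [t]
   steps, and 0 if no value has been seen yet. *)
Record evaluator k (F : pfun k) (E : seq nat -> nat) : Prop := Evaluator {
  eval_tcompute : tcompute E;
  eval_mono : forall t t' xs y, t <= t' -> E (t :: xs) = y.+1 -> E (t' :: xs) = y.+1;
  evalP : forall (xs : k.-tuple nat) y, F xs y <-> exists t, E (t :: xs) = y.+1 }.

Lemma env_map (I : Type) (g : I -> seq nat -> nat) (r : seq I) :
  (forall i, tcompute (g i)) -> env (fun s => [seq g i s | i <- r]).
Proof. by move=> Hg; elim: r => [|i r IHr] /=; solve_compute. Qed.

Lemma dcompute_all (I : Type) (b : I -> seq nat -> bool) (r : seq I) :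
  (forall i, dcompute (b i)) -> dcompute (fun s => all (fun i => b i s) r).
Proof.
by move=> Hb; elim: r => [|i r IHr] /=; [apply: tcompute_const | solve_compute].
Qed.

(** Total functions answer at time 0. Time is consumed only by minimization, where it bounds the
    search; the other constructions hand it on. *)
Lemma evaluator_total k f : tcompute f ->
  evaluator (fun (xs : k.-tuple nat) y => y = f xs) (fun s => (f (behead s)).+1).
Proof.
move=> Hf; split=> [|t t' xs y //|xs y]; first by move/tcompute_weak: Hf; solve_compute.
by split=> [->|[_ [<-]]] //; exists 0.
Qed.

(** All components run with one common time; by monotonicity the sum of their separate halting times
    suffices. *)
Lemma evaluator_comp k m (F : pfun m) (G : 'I_m -> pfun k) EF EG :
  evaluator F EF -> (forall i, evaluator (G i) (EG i)) ->
  exists E, evaluator (fun xs y => exists2 ys : m.-tuple nat,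
                         forall i, G i xs (tnth ys i) & F ys y) E.
Proof.
move=> [compF monoF evF] evG.
have compG i : tcompute (EG i) by case: (evG i).
have monoG i := eval_mono (evG i).
pose args s := [seq (EG i s).-1 | i <- enum 'I_m].
pose ok s := all (fun i => 0 < EG i s) (enum 'I_m).
have okP s : reflect (forall i, 0 < EG i s) (ok s).
  by apply: (iffP allP) => [H i|H i _]; apply: H; rewrite ?mem_enum.
exists (fun s => if ok s then EF (nth 0 s 0 :: args s) else 0); split.
- have Hok : dcompute ok by apply: dcompute_all => i; solve_compute.
  have Hargs : env args by apply: env_map => i; solve_compute.
  by have HE := tcompute_env compF (env_cons (tcompute_nth 0) Hargs); solve_compute.
- move=> t t' xs y le_tt'; case: (okP _) => // posG.
  have EGS i : EG i (t' :: xs) = EG i (t :: xs).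
    rewrite -[RHS](prednK (posG i)); apply: (monoG i) le_tt' _.
    by rewrite prednK.
  have -> : args (t' :: xs) = args (t :: xs) by apply: eq_map => i; rewrite EGS.
  case: (okP _) => [_|[]] /=; first exact: monoF.
  by move=> i; rewrite EGS.
move=> xs y; split.
  case=> ys /= Gys /evF[tF EFt].
  have /choice[tG EGt] i : exists t, EG i (t :: xs) = (tnth ys i).+1.
    by apply/(evalP (evG i)).
  pose T := tF + \sum_i tG i.
  have EGT i : EG i (T :: xs) = (tnth ys i).+1.
    apply: (monoG i) (EGt i).
    by rewrite /T (bigD1 i) //= addnCA leq_addr.
  exists T; case: (okP _) => [_|[]]; last by move=> i; rewrite EGT.
  have -> : args (T :: xs) = ys.
    rewrite -[in RHS](map_tnth_enum ys); apply: eq_map => i.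
    by rewrite EGT.
  by apply: monoF EFt; apply: leq_addr.
case=> t; case: (okP _) => // posG EFt.
exists [tuple (EG i (t :: xs)).-1 | i < m] => [i|].
  apply/(evalP (evG i)); exists t; rewrite tnth_mktuple prednK //.
by apply/evF; exists t.
Qed.

Lemma evaluator_prec k (F : pfun k) (G : pfun k.+2) EF EG :
  evaluator F EF -> evaluator G EG ->
  exists E, evaluator (fun (xs : k.+1.-tuple nat) y =>
               prec_graph F G (thead xs) [tuple of behead xs] y) E.
Proof.
move=> [compF monoF evF] [compG monoG evG].
pose f s := EF (nth 0 s 0 :: behead (behead s)).
(* The accumulator is a shifted value: 0 (nothing seen yet) is passed on, otherwise [z.-1] is the
   previous value. *)
pose g m z s := if z == 0 then 0 else EG (nth 0 s 0 :: m :: z.-1 :: behead (behead s)).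
pose L s n := nat_rec (fun=> nat) (f s) (fun m z => g m z s) n.
have monoL t t' xs n y : t <= t' -> L (t :: xs) n = y.+1 -> L (t' :: xs) n = y.+1.
  move=> le_tt'; elim: n y => [|n IHn] y /=; first exact: monoF.
  rewrite /g; case E: (L (t :: xs) n) => [|z] //=.
  by rewrite (IHn _ E) /=; apply: monoG.
exists (fun s => L s (nth 0 s 1)); split.
- apply: tcompute_nat_rec; try by solve_compute.
    by apply: tcompute_env compF _; solve_compute.
  apply: tcompute_if; try by solve_compute.
  by apply: tcompute_env compG _; solve_compute.
- by move=> t t' xs y le_tt'; apply: monoL.
move=> xs y; case: xs / tupleP => n xs; rewrite theadE.
have -> : [tuple of behead [tuple of n :: xs]] = xs by apply: val_inj.
rewrite /=; elim: n y => [|n IHn] y /=; first exact: evF.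
split=> [[z /IHn[t Et] /evG[t' Et']]|[t]].
  have LnS u m : L (u :: n.+1 :: xs) m = L (u :: n :: xs) m by [].
  exists (t + t'); rewrite LnS (monoL _ _ _ _ _ (leq_addr t' t) Et) /g /=.
  by apply: monoG Et'; apply: leq_addl.
have LnS u m : L (u :: n.+1 :: xs) m = L (u :: n :: xs) m by [].
rewrite LnS /g; case E: (L _ n) => [|z] //= Et.
by exists z; [apply/IHn; exists t | apply/evG; exists t].
Qed.

Lemma evaluator_min k (F : pfun k.+1) EF : evaluator F EF ->
  exists E, evaluator (fun (xs : k.-tuple nat) y =>
               F [tuple of y :: xs] 0 /\
               forall z, z < y -> exists v, F [tuple of z :: xs] v.+1) E.
Proof.
move=> [compF monoF evF].
pose v y s := EF (nth 0 s 0 :: y :: behead s).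
(* States of the search: 0 while all values so far are seen and positive, 1 once an argument has no
   value yet, [y.+2] once [y] is found. The predecessor of the final state is the output of the
   evaluator. *)
pose g y r s := if r == 0 then if v y s == 0 then 1 else if v y s == 1 then y.+2 else 0
                else r.
pose L s n := nat_rec (fun=> nat) 0 (fun y r => g y r s) n.
have L0 s n : (forall z, z < n -> 1 < v z s) -> L s n = 0.
  elim: n => [|n IHn] //= vn; rewrite IHn => [|z ltzn]; last by apply: vn; lia.
  by have := vn n (leqnn _); rewrite /g /=; case: (v n s) => [|[]].
have L2 s n y : y < n -> v y s = 1 -> (forall z, z < y -> 1 < v z s) -> L s n = y.+2.
  elim: n => [|n IHn] //; rewrite ltnS leq_eqVlt => /orP[/eqP <-|ltyn] vy vz /=.
    by rewrite L0 // /g /= vy.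
  by rewrite IHn.
have LP s n : match L s n with
    | 0 => forall z, z < n -> 1 < v z s
    | y.+2 => v y s = 1 /\ forall z, z < y -> 1 < v z s
    | _ => True end.
  elim: n => [|n IHn] //=; rewrite /g; case: (L s n) IHn => [|[|y]] //= vz.
  case E: (v n s) => [|[|w]] //= z.
  by rewrite ltnS leq_eqVlt => /orP[/eqP ->|/vz] //; rewrite E.
have EP t xs y : (L (t :: xs) t).-1 = y.+1 <->
    [/\ y < t, EF (t :: y :: xs) = 1 & forall z, z < y -> 1 < EF (t :: z :: xs)].
  split=> [|[ltyt Ey Ez]]; last by rewrite (@L2 _ _ y).
  have := LP (t :: xs) t; case E: (L _ t) => [|[|w]] //= [vw vz] [<-].
  have ltwt : w < t.
    rewrite ltnNge; apply/negP => letw; suff: L (t :: xs) t = 0 by rewrite E.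
    by apply: L0 => z ltzt; apply: vz; apply: leq_trans letw.
  by split.
exists (fun s => (L s (nth 0 s 0)).-1); split.
- have Hv : tcompute (fun s => v (nth 0 s 0) (behead (behead s))).
    by apply: tcompute_env compF _; solve_compute.
  by apply: tcompute_pred; apply: tcompute_nat_rec; solve_compute.
- move=> t t' xs y le_tt' /EP[ltyt Ey Ez]; apply/EP; split.
  + exact: leq_trans le_tt'.
  + exact: monoF Ey.
  move=> z /Ez; case E: (EF _) => [|w] //; by rewrite (monoF _ _ _ _ le_tt' E).
move=> xs y; split=> [[/evF[t Et] Fz]|[t /EP[ltyt Ey Ez]]]; last first.
  split; first by apply/evF; exists t.
  move=> z /Ez; case E: (EF _) => [|[|w]] // _.
  by exists w; apply/evF; exists t.
have /choice[tz Etz] z : exists t, z < y -> 1 < EF [:: t, z & xs].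
  have [/Fz[w /evF[u Eu]]|] := ltnP z y; last by exists 0.
  by exists u; rewrite Eu.
pose T := y.+1 + t + \sum_(i < y) tz i.
exists T; apply/EP; split; first by rewrite /T; lia.
  by apply: monoF Et; rewrite /T; lia.
move=> z ltzy; have := Etz z ltzy; case E: (EF _) => [|[|w]] // _.
suff /monoF/(_ E) -> : tz z <= T by [].
rewrite /T (bigD1 (Ordinal ltzy)) //=; lia.
Qed.

(* Kleene's normal form, the step count being relative to the derivation. *)
Lemma partrec_evaluator k (F : pfun k) : partrec F -> exists E, evaluator F E.
Proof.
elim=> {k F} [k||k i|k m F G _ [EF evF] _ evG|k F G _ [EF evF] _ [EG evG]|k F _ [EF evF]|].
- by eexists; apply: evaluator_total (tcompute_const 0).
- have := @evaluator_total 1 _ (tcompute_succ (tcompute_nth 0)).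
  case=> HE mE PE; eexists; split; [exact: HE|exact: mE|] => xs y.
  by rewrite -PE /thead (tnth_nth 0).
- have [HE mE PE] := @evaluator_total k _ (tcompute_nth i).
  eexists; split; [exact: HE|exact: mE|] => xs y.
  by rewrite -PE (tnth_nth 0).
- have /choice[EG evG'] := evG.
  exact: evaluator_comp evF evG'.
- exact: evaluator_prec evF evG.
- exact: evaluator_min evF.
move=> k F G FG _ [E [HE mE PE]]; exists E; split=> // xs y.
by rewrite -FG.
Qed.

(** * Binary digits of the limit and of its approximations *)

(* The code of the string of the low [n] binary digits of [floor (2 ^ n * q) + e],
   where the string with code [v] denotes the rational [q]. For negative [q], adding
   [c * (2 ^ n).-1] instead of subtracting [c] changes nothing modulo [2 ^ n]. *)
Definition digits_code n v e :=
  let a := 2 ^ n * code_head (code_tail v) in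
  let b := code_head (code_tail (code_tail v)) in
  (2 ^ n).-1 + (if odd (code_head v) then e + (a + b) %/ b.+1 * (2 ^ n).-1
                else e + a %/ b.+1) %% 2 ^ n.

Lemma tcompute_digits_code f g h : tcompute f -> tcompute g -> tcompute h ->
  tcompute (fun s => digits_code (f s) (g s) (h s)).
Proof. by move=> Hf Hg Hh; rewrite /digits_code; solve_compute. Qed.

#[local] Hint Resolve tcompute_digits_code : comp.

Section Digits.
Local Open Scope classical_set_scope.
Local Open Scope ring_scope.
Import numFieldNormedType.Exports.

Lemma rat_of_bits_code v : rat_of_bits (bits_of_nat v) =
  (-1) ^+ code_head v * (code_head (code_tail v))%:R /
  (code_head (code_tail (code_tail v))).+1%:R.
Proof.
rewrite /rat_of_bits bits_of_natK /code_tail /code_head !CodeSeq.codeK.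
by case: (CodeSeq.decode v) => [|? [|? []]].
Qed.

Lemma floor_divn (a b : nat) : Num.floor (a%:R / b.+1%:R : rat) = (a %/ b.+1)%N.
Proof.
apply: floor_def; rewrite ler_pdivlMr ?ltr0n // ltr_pdivrMr ?ltr0n //.
rewrite rmorphD /= -!pmulrn -natrD -!natrM ler_nat ltr_nat leq_divM /=.
by rewrite addn1 ltn_ceil.
Qed.

(** [(a + b) %/ b.+1] is the ceiling of the quotient of [a] by [b.+1]. *)
Lemma floor_oppr_divn (a b : nat) :
  Num.floor (- (a%:R / b.+1%:R) : rat) = - ((a + b) %/ b.+1)%N%:Z.
Proof.
set c := ((a + b) %/ b.+1)%N.
have hi : (a <= c * b.+1)%N by have := ltn_ceil (a + b) (ltn0Sn b); rewrite -/c; lia.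
have lo : (c * b.+1 <= a + b)%N by apply: leq_divM.
apply: floor_def; rewrite rmorphN /= lerN2 ler_pdivrMr ?ltr0n //.
rewrite -pmulrn -natrM ler_nat hi /=.
rewrite ltrNl rmorphD rmorphN /= opprD opprK ltr_pdivlMr ?ltr0n //.
rewrite mulrBl mul1r ltrBlDr -pmulrn -natrM -natrD ltr_nat; lia.
Qed.

Lemma digits_codeE n v e : (digits_code n v e)%:Z =
  (2 ^ n)%N.-1%:Z +
  ((Num.floor (2 ^+ n * rat_of_bits (bits_of_nat v)) + e%:Z) %% (2 ^ n)%N%:Z)%Z.
Proof.
rewrite rat_of_bits_code /digits_code PoszD; congr (_ + _); rewrite -modz_nat.
set a := code_head (code_tail v); set b := code_head (code_tail (code_tail v)).
have pos2 : (0 < 2 ^ n)%N by rewrite expn_gt0.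
rewrite -signr_odd mulrA (mulrCA (2 ^+ n)) -[2 ^+ n](natrX rat 2 n) -natrM.
case: (odd _); rewrite ?expr1 ?expr0 ?mulN1r ?mul1r ?mulNr.
  rewrite floor_oppr_divn; set c := (_ %/ _)%N.
  rewrite -[RHS](modzMDl c%:Z); congr (_ %% _)%Z; move: (2 ^ n)%N pos2 => k.
  by case: k => // k _; rewrite /= PoszD PoszM; lia.
by rewrite floor_divn addrC.
Qed.

(** The strings of length [n] have the codes from [2 ^ n - 1] on, whence the first summand. In the
    induction, [floor (2 * x)] is [2 * floor x] plus a bit, and that bit is the parity of its
    absolute value, for negative [alpha] as well. *)
Lemma nat_of_bits_first_digits (R : realType) (alpha : R) n :
  (nat_of_bits (first_digits alpha n))%:Z =
  (2 ^ n)%N.-1%:Z + (Num.floor (2 ^+ n * alpha) %% (2 ^ n)%N%:Z)%Z.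
Proof.
elim: n => [|n IHn]; first by rewrite modz1.
have -> : first_digits alpha n.+1 =
    rcons (first_digits alpha n) (odd `|Num.floor (2 ^+ n.+1 * alpha)|%N).
  by rewrite /first_digits mkseqS.
rewrite nat_of_bits_rcons exprS -mulrA.
move: IHn; set x := 2 ^+ n * alpha; set A := Num.floor x; set A' := Num.floor (2 * x).
move: (nat_of_bits _) => N EN.
have /andP[lo hi] := floor_itv x.
have lo' : 2 * A <= A'.
  by rewrite floor_ge_int intrM ler_pM2l.
have hi' : A' < 2 * A + 2.
  rewrite floor_lt_int -[2 * A + 2]/(2 * A + 2 * 1) -mulrDr intrM ltr_pM2l //.
have pos2 : (0 < 2 ^ n)%N by rewrite expn_gt0.
have EA := divz_eq A (2 ^ n)%N.
have rlo := modz_ge0 A (_ : (2 ^ n)%N%:Z != 0).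
have rhi := ltz_pmod A (_ : 0 < (2 ^ n)%N%:Z).
rewrite expnS; move: (2 ^ n)%N pos2 EN EA rlo rhi => k pos2.
move: (A %/ k)%Z (A %% k)%Z => Q r EN EA rlo rhi.
have {}rlo : 0 <= r by apply: rlo; lia.
have {}rhi : r < k by apply: rhi; lia.
have EA' : A' = Q * (2 * k)%N%:Z + (2 * r + (A' - 2 * A)) by rewrite PoszM; lia.
rewrite {2}EA' modzMDl modz_small; last by lia.
clear EA'.
have -> : odd `|A'| = (A' - 2 * A == 1) by lia.
lia.
Qed.

Lemma eqz_mod_near (a b d : int) :
  `|a - b| < d -> (a %% d)%Z = (b %% d)%Z -> a = b.
Proof.
move=> lt /eqP; rewrite eqz_mod_dvd => /dvdzP[k Ek].
suff k0 : k = 0 by apply/eqP; rewrite -subr_eq0 Ek k0 mul0r.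
apply/eqP; rewrite -absz_eq0 -leqn0 -ltnS.
have d_gt0 : 0 < d by apply: le_lt_trans lt.
by move: lt; rewrite Ek normrM [`|d|]gtr0_norm // -{2}[d]mul1r ltr_pM2r.
Qed.

(* The correction [e] is 1 exactly when [alpha] is a dyadic rational that the
   approximations never reach: then they settle on [2 ^ n * alpha - 1]. *)
Lemma floor_settles (R : realType) (alpha : R) (q : nat -> rat) :
  nondecreasing_seq q -> (fun k => ratr (q k) : R) @ \oo --> alpha ->
  exists e : bool, exists n1, forall n, (n1 <= n)%N ->
  exists S, forall s, (S <= s)%N ->
    Num.floor (2 ^+ n * q s) + (e : nat)%:Z = Num.floor (2 ^+ n * alpha).
Proof.
move=> ndq cvq.
have floorE n s : Num.floor (2 ^+ n * q s) = Num.floor (2 ^+ n * ratr (q s) : R).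
  by rewrite -[LHS](floor_rat R) rmorphM rmorphXn /= ratr_nat.
have pos2 n : 0 < 2 ^+ n :> R by rewrite exprn_gt0.
have le_q s : ratr (q s) <= alpha.
  have ndR : nondecreasing_seq (fun k => ratr (q k) : R).
    by move=> m n lemn; rewrite ler_rat; apply: ndq.
  rewrite -(cvg_lim _ cvq) //; apply: nondecreasing_cvgn_le ndR _ s.
  by apply/cvg_ex; exists alpha.
have le_floor n s : Num.floor (2 ^+ n * q s) <= Num.floor (2 ^+ n * alpha).
  by rewrite floorE; apply: le_floor; rewrite ler_pM2l.
have nd_floor n s t : (s <= t)%N -> Num.floor (2 ^+ n * q s) <= Num.floor (2 ^+ n * q t).
  by move=> lest; apply: Num.Theory.le_floor; rewrite ler_pM2l ?exprn_gt0 ?ndq.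
have near_q n (x : R) : x < 2 ^+ n * alpha -> exists S, x < 2 ^+ n * ratr (q S).
  move=> ltx; have lt : x / 2 ^+ n < alpha by rewrite ltr_pdivrMr // mulrC.
  have [S _ HS] := cvgr_gt _ cvq _ lt.
  by exists S; rewrite mulrC -ltr_pdivrMr //; apply: HS => /=.
(* Either the floor of [2 ^ n * alpha] is reached for every [n], or it is missed forever at some
   [n1]. *)
case: (pselect (forall n, exists S, Num.floor (2 ^+ n * q S) = Num.floor (2 ^+ n * alpha))).
  move=> settle; exists false, 0%N => n _; have [S ES] := settle n.
  exists S => s leSs; apply/eqP; rewrite addr0 eq_le le_floor -ES.
  exact: nd_floor.
move/existsNP => [n1 /forallNP never]; exists true, n1 => n len1n.
have lt1 s : 2 ^+ n1 * ratr (q s) < (Num.floor (2 ^+ n1 * alpha))%:~R :> R.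
  rewrite -floor_lt_int -floorE lt_neqAle le_floor andbT.
  by apply/eqP; apply: never.
(* Were [2 ^+ n1 * alpha] above its floor, some approximation would exceed that floor too, against
   [lt1]. *)
have alpha1 : 2 ^+ n1 * alpha = (Num.floor (2 ^+ n1 * alpha))%:~R.
  apply/eqP; rewrite eq_le floor_le andbT leNgt; apply/negP => /near_q[S].
  by apply/negP; rewrite -leNgt ltW.
have alphan : 2 ^+ n * alpha = (Num.floor (2 ^+ n * alpha))%:~R.
  suff -> : 2 ^+ n * alpha = (2 ^+ (n - n1) * Num.floor (2 ^+ n1 * alpha))%:~R.
    by rewrite intrKfloor.
  by rewrite intrM -alpha1 mulrA rmorphXn /= -exprD subnK.
have [S ltS] : exists S, 2 ^+ n * alpha - 1 < 2 ^+ n * ratr (q S).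
  by apply: near_q; rewrite gtrBl.
exists S => s leSs.
have ltn' : Num.floor (2 ^+ n * q s) < Num.floor (2 ^+ n * alpha).
  rewrite floorE floor_lt_int -alphan ltr_pM2l // -(ltr_pM2l (pos2 n1)).
  by rewrite [ltRHS]alpha1.
have: Num.floor (2 ^+ n * alpha) - 1 <= Num.floor (2 ^+ n * q S).
  by rewrite floorE floor_ge_int rmorphB /= -alphan ltW.
by have := nd_floor n _ _ leSs; rewrite /=; lia.
Qed.

(** Right digits determine the floor only modulo [2 ^ n]. From [s0] on the corrected floor differs
    from that of [2 ^ n * alpha] by less than [2 ^ n], so right digits mean the right floor, and by
    monotonicity it no longer moves. The stage [s0] does not depend on [n]. *)
Lemma digits_code_settle (R : realType) (alpha : R) (v : nat -> nat) :
  let q k := rat_of_bits (bits_of_nat (v k)) in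
  nondecreasing_seq q -> (fun k => ratr (q k) : R) @ \oo --> alpha ->
  exists e : bool, exists n1, exists s0, forall n, (n1 <= n)%N ->
    (exists2 S, (s0 <= S)%N &
       digits_code n (v S) e = nat_of_bits (first_digits alpha n)) /\
    (forall s t, (s0 <= s <= t)%N ->
       digits_code n (v s) e = nat_of_bits (first_digits alpha n) ->
       digits_code n (v t) e = nat_of_bits (first_digits alpha n)).
Proof.
move=> q ndq cvq; have [e [n1 settle]] := floor_settles ndq cvq.
have floorE n s : Num.floor (2 ^+ n * q s) = Num.floor (2 ^+ n * ratr (q s) : R).
  by rewrite -[LHS](floor_rat R) rmorphM rmorphXn /= ratr_nat.
have nd_floor n s t : (s <= t)%N -> Num.floor (2 ^+ n * q s) <= Num.floor (2 ^+ n * q t).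
  by move=> lest; apply: Num.Theory.le_floor; rewrite ler_pM2l ?exprn_gt0 ?ndq.
have [s0 Hs0] : exists s0, alpha - 2^-1 < ratr (q s0).
  have lt : alpha - 2^-1 < alpha by rewrite gtrBl invr_gt0.
  by have [s0 _ H] := cvgr_gt _ cvq _ lt; exists s0; apply: H => /=.
(* The successor makes [n] positive, so that half of [2 ^ n] is the integer [2 ^ n.-1]. *)
exists e, n1.+1, s0 => n ltn1n.
have [S HS] := settle n (ltnW ltn1n).
have toE s : Num.floor (2 ^+ n * q s) + (e : nat)%:Z = Num.floor (2 ^+ n * alpha) ->
    digits_code n (v s) e = nat_of_bits (first_digits alpha n).
  move=> E; apply/eqP; rewrite -eqz_nat digits_codeE nat_of_bits_first_digits.
  by rewrite -/(q s) E.
split; first by exists (maxn s0 S); rewrite ?leq_maxl //; apply/toE/HS/leq_maxr.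
move=> s t /andP[les0s lest] /eqP; rewrite -eqz_nat digits_codeE.
rewrite nat_of_bits_first_digits -/(q s) (inj_eq (addrI _)) => /eqP Emod.
apply: toE; have Et := HS (maxn t S) (leq_maxr _ _).
have le1 := nd_floor n _ _ lest; have le2 := nd_floor n _ _ (leq_maxl t S).
have le0 := nd_floor n _ _ les0s.
have {}Emod := eqz_mod_near _ Emod.
suff : Num.floor (2 ^+ n * q s) + (e : nat)%:Z = Num.floor (2 ^+ n * alpha) by lia.
apply: Emod; rewrite ltr_norml.
have ge_floor : Num.floor (2 ^+ n * alpha) - (2 ^ n.-1)%N%:Z <= Num.floor (2 ^+ n * q s0).
  rewrite floorE floor_ge_int rmorphB /= -pmulrn natrX.
  have /ltW : 2 ^+ n * (alpha - 2^-1) < 2 ^+ n * ratr (q s0) by rewrite ltr_pM2l ?exprn_gt0.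
  apply: le_trans; rewrite mulrBr lerB ?floor_le //.
  by rewrite -[in leLHS](ltn_predK ltn1n) exprSr mulfK ?pnatr_eq0 //.
have : (2 ^ n = 2 * 2 ^ n.-1)%N by rewrite -expnS prednK //; lia.
have : (0 < 2 ^ n.-1)%N by rewrite expn_gt0.
lia.
Qed.

End Digits.

(** * Machines built from partial recursive graphs *)

(** Two values of the same argument would both be shown by the evaluator at the sum of their
    times. *)
Lemma partrec_functional k (F : pfun k) xs y z :
  partrec F -> F xs y -> F xs z -> y = z.
Proof.
case/partrec_evaluator => E [_ mE PE] /PE[t Et] /PE[u Eu].
have := mE _ (t + u) _ _ (leq_addr u t) Et.
by rewrite (mE _ (t + u) _ _ (leq_addl t u) Eu) => -[].
Qed.

(** The output is picked by choice; single-valuedness of partial recursive graphs makes the pick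
    unique. *)
Definition machine_of (F : seq nat -> nat -> Prop) : machine := fun x y =>
  if pselect (exists z, F [:: nat_of_bits x; nat_of_bits y] z) is left ex
  then Some (bits_of_nat (projT1 (cid ex))) else None.

Lemma machine_ofP F x y z : pcompute F ->
  machine_of F x y = Some z <-> F [:: nat_of_bits x; nat_of_bits y] (nat_of_bits z).
Proof.
move=> HF; rewrite /machine_of; case: pselect => [ex|nex]; last first.
  by split=> // Fz; case: nex; exists (nat_of_bits z).
case: cid => w /= Fw; split=> [[<-]|Fz]; first by rewrite bits_of_natK.
rewrite (partrec_functional (xs := [tuple nat_of_bits x; nat_of_bits y]) (HF 2) Fw Fz).
by rewrite nat_of_bitsK.
Qed.

Lemma pcomputable2_machine_of F : pcompute F -> pcomputable2 (machine_of F).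
Proof.
move=> HF; exists (fun xs : 2.-tuple nat => F xs); first exact: HF.
by move=> x y z; apply: machine_ofP.
Qed.

Lemma pcompute_partrec2 (F : pfun 2) f g : partrec F -> tcompute f -> tcompute g ->
  pcompute (fun s => F [tuple f s; g s]).
Proof.
move=> HF Hf Hg k.
have Hfg (i : 'I_2) : tcompute (nth (fun=> 0) [:: f; g] i) by case: i => -[|[|i]].
apply: pr_ext (partrec_comp k HF Hfg) => xs y.
suff -> : [tuple nth (fun=> 0) [:: f; g] i xs | i < 2] = [tuple f xs; g xs] by [].
by apply: eq_from_tnth => -[[|[|i]] lti] //; rewrite tnth_mktuple (tnth_nth 0).
Qed.

Lemma pcompute_find b : dcompute b ->
  pcompute (fun s y => b (y :: s) /\ forall z, z < y -> ~~ b (z :: s)).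
Proof.
move=> Hb; have Hnb : tcompute (fun s => ~~ b s) by solve_compute.
apply: pcompute_ext (pcompute_mu Hnb) => s y.
split=> -[by_ bz]; split=> [|z /bz]; first by move: by_; case: (b _).
- by case: (b _).
- by rewrite by_.
by case: (b _).
Qed.

(** The factor [2 ^ a] is a unary header, so the length of [m] enters with coefficient 1, as an
    additive bound on complexity requires. *)
Lemma len_code_cons a m : len (code_cons a m) <= a + 1 + len m.
Proof.
rewrite len_le code_consE addn1 addSnnS -addnS expnD !expnS.
have := len_bounds m; rewrite expnS; have : 0 < 2 ^ a by rewrite expn_gt0.
move: (2 ^ a) (2 ^ len m) => x y; nia.
Qed.

Lemma nat_of_bits_nseq_false n : nat_of_bits (nseq n false) = (2 ^ n).-1.
Proof.
elim: n => [|n IHn] //; rewrite -addn1 nseqD cats1 nat_of_bits_rcons IHn addn1 expnS.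
have : 0 < 2 ^ n by rewrite expn_gt0.
lia.
Qed.

(** * Computing complexity from the digits *)

Section ReferenceMachine.
Variables (U : machine) (F : pfun 2) (E : seq nat -> nat).
Hypothesis optU : additively_optimal U.
Hypothesis recF : partrec F.
Hypothesis UF : forall x y z,
  U x y = Some z <-> F [tuple nat_of_bits x; nat_of_bits y] (nat_of_bits z).
Hypothesis evE : evaluator F E.

Lemma tcompute_evaluator2 f g h : tcompute f -> tcompute g -> tcompute h ->
  tcompute (fun s => E [:: f s; g s; h s]).
Proof. by move=> Hf Hg Hh; apply: tcompute_env (eval_tcompute evE) _; solve_compute. Qed.
#[local] Hint Resolve tcompute_evaluator2 : comp.

Lemma evaluatorP p x z : U p x = Some z <->
  exists t, E [:: t; nat_of_bits p; nat_of_bits x] = (nat_of_bits z).+1.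
Proof. by rewrite UF (evalP evE). Qed.

(** Optimality applied to the machine that runs [U] and then [T]. It turns the hypothesis on the
    complexity of [n] into one on that of [0_n]. *)
Lemma plainC_map_le T : (forall f, tcompute f -> tcompute (fun s => T (f s))) ->
  exists c, forall n, plainC U (bits_of_nat (T n)) <= plainC_nat U n + c.
Proof.
move=> compT.
have HG : pcompute (fun s y => exists2 z, F [tuple nth 0 s 0; nth 0 s 1] z & y = T z).
  apply: (pcompute_bind (G := fun s y => y = T (nth 0 s 0))).
    by apply: pcompute_partrec2; solve_compute.
  exact: compT (tcompute_nth 0).
have [c Hc] := optU (pcomputable2_machine_of HG).
exists c => n; rewrite /plainC_nat; have [[p <- Up] _] := plainCP (bits_of_nat n) optU.
have [|p' le_p' Up'] := Hc p [::] (bits_of_nat (T n)).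
  apply/machine_ofP => //=; exists n; rewrite ?bits_of_natK //.
  by rewrite -[n]bits_of_natK; apply/UF.
apply: leq_trans le_p'; exact: (proj2 (plainCP _ optU)).
Qed.

(* Run the program [code_tail m] up to its halting time [t], read off [n] from the
   output, and print [n] digits of the [t]-th approximation given by the program
   [(code_head m)./2], with the parity of [code_head m] as correction. *)
Definition halting_digits (h : nat -> nat) (s : seq nat) y :=
  exists2 t, 0 < E [:: t; code_tail (nth 0 s 0); 0] /\
             (forall z, z < t -> ~~ (0 < E [:: z; code_tail (nth 0 s 0); 0])) &
  exists2 v, F [tuple (code_head (nth 0 s 0))./2; t] v &
  y = digits_code (h (E [:: t; code_tail (nth 0 s 0); 0]).-1) v
                  (odd (code_head (nth 0 s 0))).

Lemma pcompute_halting_digits h :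
  (forall f, tcompute f -> tcompute (fun s => h (f s))) ->
  pcompute (halting_digits h).
Proof.
move=> Hh.
(* The index [i] counts the intermediate values already pushed in front of the input. *)
pose m i s := code_head (nth 0 s i); pose p i s := code_tail (nth 0 s i).
apply: (pcompute_bind
  (F := fun s t => 0 < E [:: t; p 0 s; 0] /\
          forall z, z < t -> ~~ (0 < E [:: z; p 0 s; 0]))
  (G := fun s y => exists2 v, F [tuple (m 1 s)./2; nth 0 s 0] v &
     y = digits_code (h (E [:: nth 0 s 0; p 1 s; 0]).-1) v (odd (m 1 s)))).
  apply: (pcompute_find (b := fun s => 0 < E [:: nth 0 s 0; p 1 s; 0])).
  by rewrite /p; solve_compute.
apply: (pcompute_bind (F := fun s v => F [tuple (m 1 s)./2; nth 0 s 0] v)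
  (G := fun s y => y = digits_code (h (E [:: nth 0 s 1; p 2 s; 0]).-1)
                                   (nth 0 s 0) (odd (m 2 s)))).
  by apply: pcompute_partrec2; rewrite /m; solve_compute.
rewrite -/(tcompute (fun s => digits_code (h (E [:: nth 0 s 1; p 2 s; 0]).-1)
                                   (nth 0 s 0) (odd (m 2 s)))) /p /m.
solve_compute.
Qed.

(** Treats both conclusions at once: [T n] is the code of [0_n] or [n] itself, and [h] recovers [n]
    from it. Choosing [c] before [alpha] and [P] makes the bound depend on the length of [P]
    only. *)
Lemma complexity_from_digits (R : realType) (T h : nat -> nat) :
  (forall f, tcompute f -> tcompute (fun s => T (f s))) ->
  (forall f, tcompute f -> tcompute (fun s => h (f s))) -> cancel T h ->
  exists c, forall (alpha : R) (P : bitseq), enumerates_from_below U P alpha ->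
    forall N, (forall n, N <= n ->
      plainC_nat U n + (2 ^ (size P).+2 + c) < plainC U (first_digits alpha n)) ->
    exists2 g : bitseq -> bitseq -> option bitseq, pcomputable2 g &
      forall n, g (first_digits alpha n) (bits_of_nat n) =
                Some (bits_of_nat (plainC U (bits_of_nat (T n)))).
Proof.
move=> compT comph TK.
have HV := pcompute_halting_digits comph.
have [cT HcT] := plainC_map_le compT.
have [cV HcV] := optU (pcomputable2_machine_of HV).
(* [cV] is the cost of simulating [halting_digits], [cT] that of passing from [n] to [T n], and 1
   comes from [len_code_cons]. *)
exists (cV + cT + 1) => alpha P [q [Uq ndq cvq]] N HN.
have /choice[v Hv] k : exists v, F [tuple nat_of_bits P; k] v /\
    rat_of_bits (bits_of_nat v) = q k.
  have [w /UF + <-] := Uq k; rewrite bits_of_natK => Fw.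
  by exists (nat_of_bits w); rewrite nat_of_bitsK.
have compv f : tcompute f -> tcompute (fun s => v (f s)).
  move=> Hf; apply: pcompute_ext (pcompute_partrec2 recF (tcompute_const (nat_of_bits P)) Hf) => s y.
  split=> [Fy|->]; last exact: (Hv _).1.
  exact: partrec_functional recF Fy (Hv _).1.
have Eq : (fun k => rat_of_bits (bits_of_nat (v k))) = q.
  by apply/funext => k; rewrite (Hv k).2.
rewrite -{}Eq in ndq cvq.
have [e [n1 [s0 settle]]] := digits_code_settle ndq cvq.
pose C n := plainC U (bits_of_nat (T n)).
pose n0 := maxn n1 N; pose tab := mkseq C n0.
(* For [n < n0] both searches stop at once with 0, so that [G] is defined and reaches the table. *)
pose b1 s := (nth 0 s 2 < n0) ||
  (s0 <= nth 0 s 0) && (digits_code (nth 0 s 2) (v (nth 0 s 0)) e == nth 0 s 1).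
pose b2 s := (nth 0 s 3 < n0) || (E [:: nth 0 s 1; nth 0 s 0; 0] == (T (nth 0 s 3)).+1).
pose res s := if nth 0 s 3 < n0 then nth 0 tab (nth 0 s 3) else len (nth 0 s 0).
pose G s y := exists2 u, b1 (u :: s) /\ (forall z, z < u -> ~~ b1 (z :: s)) &
  exists2 p, b2 (p :: u :: s) /\ (forall z, z < p -> ~~ b2 (z :: u :: s)) &
  y = res (p :: u :: s).
have HG : pcompute G.
  have /pcompute_find H1 : dcompute b1 by rewrite /b1; solve_compute.
  have /pcompute_find H2 : dcompute b2 by rewrite /b2; solve_compute.
  have H3 : tcompute res by rewrite /res; solve_compute.
  exact: pcompute_bind H1 (pcompute_bind H2 H3).
exists (machine_of G); first exact: pcomputable2_machine_of.
move=> n; apply/machine_ofP => //=; rewrite !bits_of_natK.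
have [ltn|len0] := ltnP n n0.
  exists 0; first by rewrite /b1 /= ltn.
  exists 0; first by rewrite /b2 /= ltn.
  by rewrite /res /= ltn nth_mkseq.
have [len1 leN] : n1 <= n /\ N <= n by move: len0; rewrite /n0; lia.
have [[S leS ES] stay] := settle n len1.
set x := nat_of_bits (first_digits alpha n) in ES stay *.
have nltn : (n < n0) = false by lia.
have exu : exists u, b1 [:: u; x; n].
  by exists S; rewrite /b1 /= ES leS eqxx orbT.
case: (ex_minnP exu) => u b1u minu.
have /andP[les0u /eqP Eu] : (s0 <= u) && (digits_code n (v u) e == x).
  by move: b1u; rewrite /b1 /= nltn.
have [[p size_p Up] leC] := plainCP (bits_of_nat (T n)) optU.
have ext : exists t, 0 < E [:: t; nat_of_bits p; 0].
  by have /evaluatorP[t Et] := Up; exists t; rewrite Et.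
have Et w : 0 < E [:: w; nat_of_bits p; 0] -> E [:: w; nat_of_bits p; 0] = (T n).+1.
  move=> Ew; rewrite -(prednK Ew); congr _.+1; move/UF: Up; rewrite bits_of_natK.
  by apply: partrec_functional recF _; apply/(evalP evE); exists w; rewrite /= prednK.
case: (ex_minnP ext) => t Et_gt0 mint.
have letu : t <= u.
  rewrite leqNgt; apply/negP => ltut.
  (* Halving returns [P], parity returns the correction; [a < 2 ^ (size P).+2] by
     [nat_of_bits_bounds]. *)
  pose a := (nat_of_bits P).*2 + e.
  have Ea : a./2 = nat_of_bits P /\ odd a = e by rewrite /a; case: (e); split; lia.
  have [|p' le_p' Up'] := HcV (bits_of_nat (code_cons a (nat_of_bits p))) [::]
                              (first_digits alpha n).
    apply/machine_ofP => //; rewrite bits_of_natK /halting_digits /=.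
    rewrite code_head_cons code_tail_cons Ea.1 Ea.2; exists t.
      by split=> // z ltzt; apply/negP => /mint; lia.
    exists (v t); first exact: (Hv t).1.
    by rewrite Et //= TK (stay u t) // les0u ltnW.
  have := (plainCP (first_digits alpha n) optU).2 _ Up'.
  have := HN n leN; have := HcT n; have := len_code_cons a (nat_of_bits p).
  have /andP[_] := nat_of_bits_bounds P.
  rewrite len_nat_of_bits size_p; move: le_p'; rewrite -/(len _) /a !expnS.
  by case: (e); lia.
have Eup : E [:: u; nat_of_bits p; 0] = (T n).+1.
  by apply: (eval_mono evE) letu (Et _ Et_gt0).
have exp : exists r, b2 [:: r; u; x; n].
  by exists (nat_of_bits p); rewrite /b2 /= Eup eqxx orbT.
case: (ex_minnP exp) => r b2r minr.
exists u; first by split=> // z ltzu; apply/negP => /minu; lia.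
exists r; first by split=> // z ltzr; apply/negP => /minr; lia.
(* The string with code [r] is a program for [T n], so it is no shorter than [p]; and [p] too has
   halted by stage [u], so [r] is at most its code. *)
rewrite /res /= nltn; apply/eqP; rewrite eqn_leq; apply/andP; split.
  apply: leC; apply/evaluatorP; exists u; rewrite !bits_of_natK.
  by move: b2r; rewrite /b2 /= nltn => /eqP.
rewrite -size_p -len_nat_of_bits; apply: leq_len; apply: minr.
by rewrite /b2 /= Eup eqxx orbT.
Qed.

End ReferenceMachine.

Theorem theorem1 (R : realType) (U : machine) (HU : reference_machine U) :
  exists2 D : nat -> nat, computable_nat D &
    forall (alpha : R) (P : bitseq), enumerates_from_below U P alpha ->
    forall N : nat,
    (forall n : nat, N <= n ->
       plainC_nat U n + D (size P) < plainC U (first_digits alpha n)) ->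
    (exists2 f : bitseq -> bitseq -> option bitseq, pcomputable2 f &
       forall n : nat, f (first_digits alpha n) (bits_of_nat n) =
                       Some (bits_of_nat (plainC U (nseq n false)))) /\
    (exists2 g : bitseq -> bitseq -> option bitseq, pcomputable2 g &
       forall n : nat, g (first_digits alpha n) (bits_of_nat n) =
                       Some (bits_of_nat (plainC_nat U n))).
Proof.
have [[F recF UF] _ optU] := HU.
have [E evE] := partrec_evaluator recF.
(* [0_n] has code [2 ^ n - 1], and its length gives [n] back. *)
have comp0 f : tcompute f -> tcompute (fun s => (2 ^ f s).-1) by move=> Hf; solve_compute.
have K0 : cancel (fun n => (2 ^ n).-1) len.
  by move=> n; rewrite -nat_of_bits_nseq_false len_nat_of_bits size_nseq.
have [c0 H0] := complexity_from_digits optU recF UF evE R comp0 tcompute_len K0.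
have [c1 H1] := complexity_from_digits optU recF UF evE R (T := id) (h := id)
                  (fun f Hf => Hf) (fun f Hf => Hf) (fun=> erefl).
exists (fun l => 2 ^ l.+2 + maxn c0 c1).
  have HD : tcompute (fun s => 2 ^ (nth 0 s 0).+2 + maxn c0 c1) by solve_compute.
  by apply: pr_ext (HD 1) => xs y; rewrite /thead (tnth_nth 0).
move=> alpha P enumP N HN; split.
  have [|f compf Hf] := H0 alpha P enumP N.
    by move=> n /HN; apply: leq_ltn_trans; rewrite !leq_add2l leq_maxl.
  by exists f => // n; rewrite Hf -nat_of_bits_nseq_false nat_of_bitsK.
apply: (H1 alpha P enumP N) => n /HN; apply: leq_ltn_trans.
by rewrite !leq_add2l leq_maxr.
Qed.
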